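(* Let $\Gamma$ be a group and $M$ a conical $\Gamma$-monoid such that $M\neq\{0\}$. Then the following hold. (i) For $x\in M$: $D(x)=\emptyset$ if and only if $x\in \operatorname{Nil}(M)$. (ii) $D(x)\cap D(y)=D(\langle x\rangle\cap\langle y\rangle)$ for all $x,y\in M$. (iii) $\overline{\{P\}}=V(P)$ for any $P\in \operatorname{Spec}_\Gamma(M)$. (iv) $\operatorname{Spec}_\Gamma(M)$ is $T_0$. (v) $V(J)=V(\operatorname{rad}(J))$ for any $\Gamma$-order ideal $J$ of $M$. (vi) For any $\Gamma$-order ideal $J$ of $M$, $\operatorname{rad}(J)$ is prime if and only if $V(J)$ is a nonempty irreducible subset of $\operatorname{Spec}_\Gamma(M)$. (vii) $\operatorname{Spec}_\Gamma(M)$ is sober, i.e., every nonempty irreducible closed set has a unique generic point. (viii) $\operatorname{Spec}_\Gamma(M)$ is spectral in the sense of Hofmann--Keimel. Furthermore, if $M$ is a refinement monoid, then: (1) for $x\in M$, $D(x)=\operatorname{Spec}_\Gamma(M)$ if and only if $x$ is an order unit in $M$; (2) for any $P\in\operatorname{Spec}_\Gamma(M)$, $\{P\}$ is closed if and only if $P$ is maximal; (3) $J=\operatorname{rad}(J)$ for any $\Gamma$-order ideal $J$ of $M$; in particular, $\operatorname{Nil}(M)=\{0\}$; (4) for $x\in M$, $D(x)=\emptyset$ if and only if $x=0$; (5) $D(x)$ is compact for all $x\in M$; in particular, $\operatorname{Spec}_\Gamma(M)$ is compact. If, in addition, each $\Gamma$-order ideal of $M$ is finitely generated, then $\operatorname{Spec}_\Gamma(M)$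 is spectral in the sense of Hochster.
   Context: All monoids are commutative, written additively with identity $0$. The algebraic preorder on a monoid $M$ is: $x\le y$ iff $y=x+z$ for some $z\in M$. $M$ is conical if $x+y=0$ implies $x=y=0$. $M$ is a refinement monoid if whenever $a+b=c+d$ in $M$ there are $z_1,z_2,z_3,z_4\in M$ with $a=z_1+z_2$, $b=z_3+z_4$, $c=z_1+z_3$, $d=z_2+z_4$. For a group $\Gamma$, a $\Gamma$-monoid is a monoid $M$ with an action of $\Gamma$ by monoid automorphisms, written ${}^{\gamma}x$. The group semiring $\mathbb{N}[\Gamma]$ ($\mathbb N\ni 0$) acts by ${}^{(\sum_i n_i\gamma_i)}x:=\sum_i n_i\,{}^{\gamma_i}x$. An element $\epsilon\in M$ is an order unit if for every $x\in M$ there is $\alpha\in\mathbb{N}[\Gamma]$ with $x\le {}^{\alpha}\epsilon$. A $\Gamma$-order ideal of $M$ is a submonoid that is a down-set for $\le$ and is closed under the $\Gamma$-action. For $\emptyset\ne X\subseteq M$, the $\Gamma$-order ideal generated by $X$ is $\langle X\rangle=\{y\in M : y\le \sum_{i=1}^t {}^{\alpha_i}x_i \text{ for some } t\in\mathbb N,\ \alpha_i\in\mathbb N[\Gamma],\ x_i\in X\}$, $\langle\emptyset\rangle=\{0\}$, and $\langle x\rangle:=\langle\{x\}\rangle$. A $\Gamma$-order ideal is finitely generated if it equals $\langle X\rangle$ for a finite $X$. A proper $\Gamma$-order ideal $P$ is prime if for all $\Gamma$-order ideals $J_1,J_2$, $J_1\cap J_2\subseteq P$ implies $J_1\subseteq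 P$ or $J_2\subseteq P$; a proper $\Gamma$-order ideal $J$ is maximal if the only $\Gamma$-order ideals $I$ with $J\subseteq I\subseteq M$ are $J$ and $M$. $\operatorname{Spec}_\Gamma(M)$ is the set of prime $\Gamma$-order ideals of $M$. For a $\Gamma$-order ideal $J$ and $x\in M$: $V(J)=\{P\in \operatorname{Spec}_\Gamma(M): J\subseteq P\}$, $D(J)=\{P\in \operatorname{Spec}_\Gamma(M): J\nsubseteq P\}$, $D(x)=\{P\in \operatorname{Spec}_\Gamma(M): x\notin P\}$. The Zariski topology on $\operatorname{Spec}_\Gamma(M)$ has the sets $V(J)$ as its closed sets (the sets $D(x)$ form a basis). $\operatorname{rad}(J):=\bigcap_{P\in V(J)}P$ (an empty intersection being $M$) and $\operatorname{Nil}(M)$ is the intersection of all prime $\Gamma$-order ideals. A generic point of a closed set $C$ is a point whose closure is $C$. A topological space $X$ is spectral in the sense of Hofmann--Keimel if it is $T_0$ and every nonempty irreducible closed set has a generic point; it is spectral in the sense of Hochster if it is compact, admits a base of compact (open) sets closed under finite intersection, and is spectral in the sense of Hofmann--Keimel. Compact means every open cover has a finite subcover (no Hausdorff assumption).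
   Formalization: In (5), compactness of Spec_Γ(M) is stated only when M has an order unit; as written it fails, e.g. for the free commutative monoid on ℕ with trivial action, whose spectrum is infinite discrete. *)

(* Defs.v *)
From HB Require Import structures.
From mathcomp Require Import all_boot all_algebra finmap.
From mathcomp Require Import boolp classical_sets cardinality topology.

Set Implicit Arguments.
Unset Strict Implicit.
Unset Printing Implicit Defensive.

Import GRing.Theory.
Local Open Scope classical_set_scope.
Local Open Scope ring_scope.

(* [nmodType] is the type of commutative monoids in additive notation.  By the
   group laws, each [gact g] is an automorphism with inverse [gact g^-1]. *)
HB.mixin Record Nmodule_isGMonoid (G : groupType) M & GRing.Nmodule M := {
  gact : G -> M -> M;
  gact1 : forall x : M, gact 1%g x = x;
  gactM : forall (g h : G) (x : M), gact (g * h)%g x = gact g (gact h x);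
  gact0 : forall g : G, gact g 0 = 0;
  gactD : forall (g : G) (x y : M), gact g (x + y) = gact g x + gact g y
}.

#[short(type="gMonoidType")]
HB.structure Definition GMonoid (G : groupType) :=
  { M of GRing.Nmodule M & Nmodule_isGMonoid G M }.

(* Only the underlying set of the group semiring is needed: an element is its
   finitely supported family of coefficients. *)
Definition group_semiring (G : groupType) := {fsfun G -> nat with 0%N}.

Section GMonoidTheory.
Context {G : groupType} {M : gMonoidType G}.
Implicit Types (x y z : M) (J P X : set M).

Definition alg_le x y := exists z, y = x + z.

Definition gsact (a : group_semiring G) x : M :=
  \sum_(g <- finsupp a) gact g x *+ a g.

Definition order_unit (e : M) :=
  forall x, exists a : group_semiring G, alg_le x (gsact a e).

Definition gideal J :=
  [/\ J 0,
      forall x y, J x -> J y -> J (x + y),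
      forall x y, alg_le x y -> J y -> J x
    & forall (g : G) x, J x -> J (gact g x)].

Definition gideal_gen X : set M :=
  if X == set0 then [set 0] else
  [set y | exists (t : nat) (a : 'I_t -> group_semiring G) (x : 'I_t -> M),
             (forall i, X (x i)) /\ alg_le y (\sum_(i < t) gsact (a i) (x i))].

Definition finitely_generated J := exists2 X, finite_set X & J = gideal_gen X.

Definition prime_gideal P :=
  [/\ gideal P, P <> setT
    & forall J1 J2, gideal J1 -> gideal J2 ->
        J1 `&` J2 `<=` P -> J1 `<=` P \/ J2 `<=` P].

Definition maximal_gideal J :=
  [/\ gideal J, J <> setT
    & forall I, gideal I -> J `<=` I -> I = J \/ I = setT].

End GMonoidTheory.

Definition conical (M : nmodType) :=
  forall x y : M, x + y = 0 -> x = 0 /\ y = 0.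

Definition refinement (M : nmodType) :=
  forall a b c d : M, a + b = c + d ->
    exists z1 z2 z3 z4 : M,
      [/\ a = z1 + z2, b = z3 + z4, c = z1 + z3 & d = z2 + z4].

Record spec (G : groupType) (M : gMonoidType G) := Spec {
  spec_gideal :> set M;
  specP : prime_gideal spec_gideal
}.
Arguments spec {G} M.

HB.instance Definition _ (G : groupType) (M : gMonoidType G) :=
  gen_eqMixin (spec M).
HB.instance Definition _ (G : groupType) (M : gMonoidType G) :=
  gen_choiceMixin (spec M).

Section Zariski.
Context {G : groupType} {M : gMonoidType G}.
Implicit Types (x : M) (J : set M).

Definition specV J : set (spec M) := [set P : spec M | J `<=` P].
Definition specD J : set (spec M) := [set P : spec M | ~ (J `<=` P)].
Definition specDx x : set (spec M) := [set P : spec M | ~ (P : set M) x].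

Definition gradical J : set M := \bigcap_(P in specV J) (P : set M).

Definition zariski_open (U : set (spec M)) :=
  exists2 J, gideal J & ~` U = specV J.

Let gidealT : gideal [set: M].
Proof. by []. Qed.

Let gidealI J1 J2 : gideal J1 -> gideal J2 -> gideal (J1 `&` J2).
Proof.
move=> [a0 aD al ag] [b0 bD bl bg]; split=> //.
- by move=> x y [? ?] [? ?]; split; [exact: aD|exact: bD].
- by move=> x y le [? ?]; split; [exact: al le _|exact: bl le _].
- by move=> g x [? ?]; split; [exact: ag|exact: bg].
Qed.

Lemma zariski_openT : zariski_open setT.
Proof.
exists setT; first exact: gidealT.
rewrite setCT; apply/esym/seteqP; split=> // P PT.
by case: (specP P) => _ + _; apply; apply/seteqP; split.
Qed.

Lemma zariski_openI : setI_closed zariski_open.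
Proof.
move=> A B [J1 iJ1 eA] [J2 iJ2 eB]; exists (J1 `&` J2); first exact: gidealI.
rewrite setCI eA eB; apply/seteqP; split=> [P [] sP x []|P sP].
- by move=> /sP.
- by move=> _ /sP.
- by case: (specP P) => _ _ /(_ J1 J2); exact.
Qed.

Lemma zariski_open_bigU (I : Type) (f : I -> set (spec M)) :
  (forall i, zariski_open (f i)) -> zariski_open (\bigcup_i f i).
Proof.
move=> fo.
exists [set x | forall J, gideal J ->
    (forall i J', gideal J' -> ~` f i = specV J' -> J' `<=` J) -> J x].
  split=> [J [] //|x y Jx Jy J iJ sJ|x y le Jy J iJ sJ|g x Jx J iJ sJ].
  - by case: (iJ) => _ JD _ _; apply: JD; [exact: Jx|exact: Jy].
  - by case: (iJ) => _ _ Jl _; apply: Jl le _; exact: Jy.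
  - by case: (iJ) => _ _ _; apply; exact: Jx.
rewrite setC_bigcup; apply/seteqP; split=> [P fP x|P sP i _].
  apply; first by case: (specP P).
  by move=> i J' _ eJ'; have := fP i Logic.I; rewrite eJ'.
have [J iJ eJ] := fo i; rewrite eJ => x Jx.
by apply: sP => J0 _ /(_ i J iJ eJ); exact.
Qed.

HB.instance Definition _ := isOpenTopological.Build (spec M)
  zariski_openT zariski_openI zariski_open_bigU.

End Zariski.

Definition gnil_radical {G : groupType} (M : gMonoidType G) : set M :=
  \bigcap_(P in [set: spec M]) (P : set M).
Arguments gnil_radical {G} M.

(* The closed sets of [spec M] are exactly the [specV J]. *)
Lemma zariski_closedE {G : groupType} {M : gMonoidType G} (C : set (spec M)) :
  closed C <-> exists2 J, gideal J & C = specV J.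
Proof. by rewrite -openC /open /= /zariski_open setCK. Qed.

Section SpectralSpaces.
Context {T : topologicalType}.
Implicit Types (A C : set T).

(* Nonemptiness is not part of this notion. *)
Definition irreducible A :=
  forall C1 C2, closed C1 -> closed C2 -> A `<=` C1 `|` C2 ->
    A `<=` C1 \/ A `<=` C2.

Definition generic_point C (p : T) := closure [set p] = C.

End SpectralSpaces.

Definition sober (T : topologicalType) :=
  forall C : set T, closed C -> C !=set0 -> irreducible C ->
    exists! p, generic_point C p.

Definition spectral_HK (T : topologicalType) :=
  kolmogorov_space T /\
  (forall C : set T, closed C -> C !=set0 -> irreducible C ->
     exists p, generic_point C p).

(* Compactness is [cover_compact] throughout: the library proves it equivalent
   to the filter-based [compact] for pointed spaces only. *)
Definition spectral_Hochster (T : topologicalType) :=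
  [/\ cover_compact [set: T],
      exists B : set (set T),
        [/\ basis B, (forall U, B U -> cover_compact U) & setI_closed B]
    & spectral_HK T].

(* Main.v *)
(* Without refinement, everything rests on [V(J)] being order reversing and on
   primes being prime for intersections.  With refinement, the ideals form a
   distributive lattice, so an ideal maximal among those avoiding [x] is prime;
   Zorn's lemma then gives [J = rad J].  For compactness, the elements [y] for
   which [D(y)] is covered by finitely many members of an open cover form an
   ideal; being radical, it contains everything whose [D] is covered at all. *)

Require Import Defs.
From HB Require Import structures.
From mathcomp Require Import all_boot all_algebra finmap.
From mathcomp Require Import boolp classical_sets cardinality topology.

Set Implicit Arguments.
Unset Strict Implicit.
Unset Printing Implicit Defensive.

Import GRing.Theory.
Local Open Scope classical_set_scope.
Local Open Scope ring_scope.

Section GeneratedIdeals.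
Context {G : groupType} {M : gMonoidType G}.
Implicit Types (x y : M) (J X : set M).

Lemma gact_sum (I : Type) (r : seq I) (g : G) (F : I -> M) :
  gact g (\sum_(i <- r) F i) = \sum_(i <- r) gact g (F i).
Proof.
elim: r => [|i r IH]; first by rewrite !big_nil gact0.
by rewrite !big_cons gactD IH.
Qed.

Lemma gsact_seq (s : seq G) :
  exists a : group_semiring G,
    forall x, gsact a x = \sum_(g <- s) gact g x.
Proof.
exists [fsfun g in [fset h in s]%fset => count_mem g s] => x.
rewrite /gsact -[RHS]big_undup_iterop_count /=.
set a := fsfun_of_fun _ _ _ _.
have aE g : a g = count_mem g s.
  rewrite fsfunE !inE; case: ifPn => // /negP gs.
  by apply/esym/eqP; rewrite -leqn0 leqNgt -has_count has_pred1; apply/negP.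
have le_supp : (finsupp a `<=` [fset h in s])%fset.
  apply/fsubsetP => g; rewrite mem_finsupp aE !inE -lt0n -has_count.
  by rewrite has_pred1.
rewrite (big_fset_incl _ le_supp) => [|g _ /fsfun_dflt ->]; last first.
  by rewrite mulr0n.
have perm_s : perm_eq [fset h in s]%fset (undup s).
  apply: uniq_perm; [exact: fset_uniq|exact: undup_uniq|move=> g].
  by rewrite mem_undup !inE.
by rewrite (perm_big _ perm_s) /=; apply: eq_bigr => g _; rewrite aE.
Qed.

Lemma gideal_sum J (I : eqType) (r : seq I) (F : I -> M) :
  gideal J -> (forall i, i \in r -> J (F i)) -> J (\sum_(i <- r) F i).
Proof.
move=> [J0 JD _ _] JF; rewrite big_seq.
by elim/big_ind: _ => //.
Qed.

Lemma gideal_gsact J (a : group_semiring G) x :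
  gideal J -> J x -> J (gsact a x).
Proof.
move=> iJ Jx; apply: gideal_sum => // g _.
case: iJ => J0 JD _ Jg; elim: (a g) => [|n IH]; first by rewrite mulr0n.
by rewrite mulrS; apply: JD => //; exact: Jg.
Qed.

Lemma gideal_gen_min J X : gideal J -> X `<=` J -> gideal_gen X `<=` J.
Proof.
move=> iJ sXJ y; rewrite /gideal_gen; case: ifP => _ /=.
  by move=> ->; case: iJ.
move=> [t [a [x [Xx le_y]]]]; case: (iJ) => _ _ Jle _; apply: Jle le_y _.
by apply: gideal_sum => // i _; apply: gideal_gsact => //; exact: sXJ.
Qed.

Definition gspan X : set M :=
  [set y | exists2 s : seq (G * M), forall p, p \in s -> X p.2
         & alg_le y (\sum_(p <- s) gact p.1 p.2)].

Lemma gspan_gideal X : gideal (gspan X).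
Proof.
split=> [|x y [s Xs [z ez]] [r Xr [w ew]]|x y [z ->] [s Xs [w ew]]|
         g x [s Xs [z ez]]].
- by exists [::] => //; exists 0; rewrite big_nil addr0.
- exists (s ++ r) => [p|].
    by rewrite mem_cat => /orP[/Xs|/Xr].
  by exists (z + w); rewrite big_cat /= ez ew addrACA.
- by exists s => //; exists (z + w); rewrite ew addrA.
- exists [seq ((g * p.1)%g, p.2) | p <- s] => [_ /mapP[p ps ->]|].
    exact: Xs ps.
  exists (gact g z); rewrite big_map -gactD -ez gact_sum.
  by apply: eq_bigr => p _; rewrite gactM.
Qed.

Lemma sub_gspan X : X `<=` gspan X.
Proof.
move=> x Xx; exists [:: (1%g, x)] => [p|]; first by rewrite inE => /eqP ->.
by exists 0; rewrite big_seq1 gact1 addr0.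
Qed.

(* Conicality is needed for [X = set0] only. *)
Lemma gideal_genE X : conical M -> gideal_gen X = gspan X.
Proof.
move=> conM; apply/seteqP; split=> [|y [s Xs le_y]].
  by apply: gideal_gen_min; [exact: gspan_gideal|exact: sub_gspan].
rewrite /gideal_gen; case: ifPn => [/eqP X0|_] /=.
  have s0 : s = [::].
    by case: s Xs {le_y} => // p s /(_ p); rewrite X0 => /(_ (mem_head _ _)).
  by case: le_y => z; rewrite s0 big_nil => /esym/conM[].
have unit_ (i : 'I_(size s)) : exists a : group_semiring G,
    forall x, gsact a x = gact (tnth (in_tuple s) i).1 x.
  have [a aE] := gsact_seq [:: (tnth (in_tuple s) i).1].
  by exists a => x; rewrite aE big_seq1.
have [a aE] := choice unit_.
exists (size s), a, (fun i => (tnth (in_tuple s) i).2); split=> [i|].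
  by apply: Xs; exact: mem_tnth.
by rewrite (big_tnth _ _ s) in le_y; under eq_bigr do rewrite aE.
Qed.

Lemma gideal_gen_gideal X : conical M -> gideal (gideal_gen X).
Proof. by move=> /gideal_genE ->; exact: gspan_gideal. Qed.

Lemma sub_gideal_gen X : conical M -> X `<=` gideal_gen X.
Proof. by move=> /gideal_genE ->; exact: sub_gspan. Qed.

Lemma order_unitE x :
  conical M -> order_unit x <-> gideal_gen [set x] = setT.
Proof.
move=> conM; split=> [ux|genT y].
  apply/seteqP; split=> // y _; have [a le_y] := ux y.
  case: (gideal_gen_gideal [set x] conM) => _ _ le_closed _.
  apply: le_closed le_y _; apply: gideal_gsact; first exact: gideal_gen_gideal.
  exact: sub_gideal_gen.
have : gideal_gen [set x] y by rewrite genT.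
rewrite gideal_genE // => -[s sx le_y].
have [a aE] := gsact_seq [seq p.1 | p <- s]; exists a.
by rewrite aE big_map (eq_big_seq (fun p => gact p.1 p.2)) // => p /sx /= ->.
Qed.

Lemma gideal_bigcap (I : Type) (D : set I) (F : I -> set M) :
  (forall i, D i -> gideal (F i)) -> gideal (\bigcap_(i in D) F i).
Proof.
move=> iF; split=> [i Di|x y Fx Fy i Di|x y le Fy i Di|g x Fx i Di];
  case: (iF i Di) => F0 FD Fle Fg //.
- by apply: FD; [exact: Fx|exact: Fy].
- by apply: Fle le _; exact: Fy.
- by apply: Fg; exact: Fx.
Qed.

Lemma gideal_set0 : conical M -> gideal [set (0 : M)].
Proof.
move=> conM; split=> //= [x y -> ->|x y [z e] y0|g x ->].
- by rewrite addr0.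
- by have [] := conM x z; rewrite -?e.
- exact: gact0.
Qed.

End GeneratedIdeals.

Section PrimeSpectrum.
Context {G : groupType} {M : gMonoidType G}.
Implicit Types (x y : M) (J X : set M) (P Q : spec M).

Lemma spec_gidealP P : gideal P.
Proof. by case: (specP P). Qed.

Lemma spec_inj P Q : (P : set M) = Q -> P = Q.
Proof.
case: P Q => [P pP] [Q pQ] /= e; case: Q / e pQ => pQ.
by rewrite (Prop_irrelevance pP pQ).
Qed.

Lemma specDC J : specD J = ~` specV J.
Proof. by []. Qed.

Lemma specDxE x : conical M -> specDx x = specD (gideal_gen [set x]).
Proof.
move=> conM; apply/seteqP; split=> P /=.
  by move=> Px sP; apply/Px/sP; exact: sub_gideal_gen.
move=> nsP Px; apply: nsP; apply: gideal_gen_min; first exact: spec_gidealP.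
by move=> _ ->.
Qed.

Lemma open_specD J : gideal J -> open (specD J).
Proof. by move=> iJ; exists J; rewrite // specDC setCK. Qed.

Lemma open_specDx x : conical M -> open (specDx x).
Proof.
by move=> conM; rewrite specDxE //; apply/open_specD/gideal_gen_gideal.
Qed.

Lemma openP_specD (U : set (spec M)) :
  open U -> exists2 J, gideal J & U = specD J.
Proof. by move=> [J iJ e]; exists J; rewrite // specDC -e setCK. Qed.

Lemma closed_specV J : gideal J -> closed (specV J).
Proof. by move=> iJ; apply/zariski_closedE; exists J. Qed.

Lemma closure_spec1 P : closure [set P] = specV P.
Proof.
rewrite closureE; apply/seteqP; split=> [Q|Q sPQ C].
  apply; split; first by apply: closed_specV; exact: spec_gidealP.
  by move=> _ ->; exact: subset_refl.
move=> [/zariski_closedE[J iJ ->] sPJ].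
by apply: subset_trans sPQ; exact: sPJ.
Qed.

Lemma specD_gideal_genI x y : conical M ->
  specDx x `&` specDx y =
  specD (gideal_gen [set x] `&` gideal_gen [set y]).
Proof.
move=> conM; rewrite !specDxE //; apply/seteqP; split=> P /=.
  move=> [nxP nyP] sP; case: (specP P) => _ _.
  by move=> /(_ _ _ (gideal_gen_gideal _ conM) (gideal_gen_gideal _ conM) sP)[].
by move=> nsP; split=> sP; apply: nsP => z [? ?]; exact: sP.
Qed.

Lemma spec_kolmogorov : conical M -> kolmogorov_space (spec M).
Proof.
move=> conM P Q neqPQ.
have nbhsD z (R : spec M) : ~ (R : set M) z -> specDx z \in nbhs R.
  move=> nRz; rewrite inE; apply: open_nbhs_nbhs.
  by split=> //; exact: open_specDx.
have [sPQ|/existsNP[z /not_implyP[Pz nQz]]] := pselect ((P : set M) `<=` Q).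
  have /existsNP[z /not_implyP[Qz nPz]] : ~ ((Q : set M) `<=` P).
    by move=> sQP; move/eqP: neqPQ; apply; apply/spec_inj/seteqP; split.
  exists (specDx z); left; split; first exact: nbhsD.
  by rewrite inE => /(_ Qz).
exists (specDx z); right; split; first exact: nbhsD.
by rewrite inE => /(_ Pz).
Qed.

Lemma gradical_gideal J : gideal (gradical J).
Proof. by apply: gideal_bigcap => P _; exact: spec_gidealP. Qed.

Lemma sub_gradical J : J `<=` gradical J.
Proof. by move=> x Jx P; exact. Qed.

Lemma specV_gradical J : specV (gradical J) = specV J.
Proof.
apply/seteqP; split=> P sP; last by move=> x; exact.
by apply: subset_trans sP; exact: sub_gradical.
Qed.

Lemma gradical_prime J :
  prime_gideal (gradical J) <-> specV J !=set0 /\ irreducible (specV J).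
Proof.
split=> [pJ|[[P VP] irrJ]].
  pose R := Spec pJ.
  have VJR : specV J R by exact: sub_gradical.
  split; first by exists R.
  have sub_closed C : closed C -> C R -> specV J `<=` C.
    move=> /zariski_closedE[I iI ->] sIR Q.
    by rewrite -specV_gradical => sJQ; exact: subset_trans sJQ.
  by move=> C1 C2 cC1 cC2 /(_ R VJR)[/(sub_closed _ cC1)|/(sub_closed _ cC2)];
    [left|right].
split; first exact: gradical_gideal.
  move=> radT; case: (specP P) => _ + _; apply; apply/seteqP; split=> // x _.
  by have : gradical J x; [rewrite radT|exact].
move=> J1 J2 iJ1 iJ2 sI.
have cover_V : specV J `<=` specV J1 `|` specV J2.
  move=> Q VQ; case: (specP Q) => _ _ /(_ J1 J2 iJ1 iJ2); apply=> x /sI.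
  exact.
case: (irrJ _ _ (closed_specV iJ1) (closed_specV iJ2) cover_V) => sV.
- by left=> x J1x Q /sV; exact.
- by right=> x J2x Q /sV; exact.
Qed.

Lemma spec_generic (C : set (spec M)) :
  closed C -> C !=set0 -> irreducible C -> exists P, generic_point C P.
Proof.
move=> /zariski_closedE[J iJ ->] V0 irrV.
have pJ : prime_gideal (gradical J) by exact/gradical_prime.
by exists (Spec pJ); rewrite /generic_point closure_spec1 /= specV_gradical.
Qed.

Lemma spec_sober : sober (spec M).
Proof.
move=> C cC C0 irrC; have [P gP] := spec_generic cC C0 irrC.
exists P; split=> // Q gQ; apply/spec_inj.
have VPQ : specV P = specV Q by rewrite -!closure_spec1 gP gQ.
have PQ : specV P Q by rewrite VPQ; exact: subset_refl.
have QP : specV Q P by rewrite -VPQ; exact: subset_refl.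
by apply/seteqP; split.
Qed.

Lemma spec_spectral_HK : conical M -> spectral_HK (spec M).
Proof. by move=> conM; split; [exact: spec_kolmogorov|exact: spec_generic]. Qed.

Lemma specDx_eq0 x : specDx x = set0 <-> gnil_radical M x.
Proof.
split=> [D0 P _|nilx]; last by apply/seteqP; split=> // P; apply; exact: nilx.
by apply: contrapT => nPx; have : specDx x P by []; rewrite D0.
Qed.

End PrimeSpectrum.

Section Refinement.
Context {G : groupType} {M : gMonoidType G}.
Hypothesis refM : refinement M.
Implicit Types (x y : M) (J X : set M).

Definition gideal_add J1 J2 : set M :=
  [set x | exists2 a, J1 a & exists2 b, J2 b & x = a + b].

Lemma gideal_addP J1 J2 : gideal J1 -> gideal J2 -> gideal (gideal_add J1 J2).
Proof.
move=> [J10 J1D J1le J1g] [J20 J2D J2le J2g].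
split=> [|_ _ [a ? [b ? ->]] [c ? [d ? ->]]|x y [z ->] [a Ja [b Jb]]|
         g _ [a ? [b ? ->]]].
- by exists 0 => //; exists 0 => //; rewrite addr0.
- exists (a + c); first exact: J1D.
  by exists (b + d); [exact: J2D|rewrite addrACA].
- move=> /refM[z1 [z2 [z3 [z4 [-> _ ea eb]]]]].
  exists z1; first by apply: J1le Ja; exists z3.
  by exists z2 => //; apply: J2le Jb; exists z4.
- exists (gact g a); first exact: J1g.
  by exists (gact g b); [exact: J2g|rewrite gactD].
Qed.

Lemma gideal_add_subl J1 J2 : gideal J2 -> J1 `<=` gideal_add J1 J2.
Proof. by move=> [J20 _ _ _] x Jx; exists x => //; exists 0; rewrite ?addr0. Qed.

Lemma gideal_add_subr J1 J2 : gideal J1 -> J2 `<=` gideal_add J1 J2.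
Proof. by move=> [J10 _ _ _] x Jx; exists 0 => //; exists x; rewrite ?add0r. Qed.

Lemma gideal_addI J J1 J2 : gideal J -> gideal J1 -> gideal J2 ->
  gideal_add J J1 `&` gideal_add J J2 `<=` gideal_add J (J1 `&` J2).
Proof.
move=> [_ JD Jle _] [_ _ J1le _] [_ _ J2le _].
move=> x [[p Jp [a J1a ->]] [q Jq [b J2b /refM]]].
move=> [z1 [z2 [z3 [z4 [ep ea eq eb]]]]].
exists (p + z3).
  by apply: JD => //; apply: Jle Jq; exists z1; rewrite addrC.
exists z4; last by rewrite ea addrA.
by split; [apply: J1le J1a; exists z3|apply: J2le J2b; exists z2]; rewrite addrC.
Qed.

Lemma avoiding_prime P x : gideal P -> ~ P x ->
    (forall I, gideal I -> P `<=` I -> ~ I x -> I `<=` P) ->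
  prime_gideal P.
Proof.
move=> iP nPx maxP; split=> // [PT|J1 J2 iJ1 iJ2 sP].
  by apply: nPx; rewrite PT.
have avoid J : gideal J -> ~ (gideal_add P J) x -> J `<=` P.
  move=> iJ nx y Jy; apply: (maxP _ (gideal_addP iP iJ)) => //.
    exact: gideal_add_subl.
  exact: gideal_add_subr.
have [x1|/avoid] := pselect (gideal_add P J1 x); last by left; auto.
have [x2|/avoid] := pselect (gideal_add P J2 x); last by right; auto.
have [p Pp [a /sP Pa ex]] := gideal_addI iP iJ1 iJ2 (conj x1 x2).
by case: nPx; rewrite ex; case: iP => _ + _ _; apply.
Qed.

Lemma exists_spec_avoiding J x : gideal J -> ~ J x ->
  exists2 P : spec M, J `<=` P & ~ (P : set M) x.
Proof.
move=> iJ nJx.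
(* Uniting with [J] makes the empty chain admissible for [Zorn_bigcup]. *)
pose avoids (A : set M) := gideal (J `|` A) /\ ~ (J `|` A) x.
have [|A [[iA nAx] maxA]] := @Zorn_bigcup M avoids.
  move=> F Fav totF; split; last first.
    move=> [//|[A FA Ax]]; case: (Fav _ FA) => _; apply; by right.
  have JF A : F A -> J `|` A `<=` J `|` \bigcup_(X in F) X.
    by move=> FA y [|Ay]; [left|right; exists A].
  have [-> |/set0P[A0 FA0]] := eqVneq F set0; first by rewrite bigcup_set0 setU0.
  have inF y : (J `|` \bigcup_(X in F) X) y -> exists2 A, F A & (J `|` A) y.
    by move=> [Jy|[A FA Ay]]; [exists A0 => //; left|exists A => //; right].
  split=> [|y z /inF[A FA Ay] /inF[B FB Bz]|y z le /inF[A FA Az]|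
           g y /inF[A FA Ay]].
  - by left; case: iJ.
  - have [sAB|sBA] := totF A B FA FB.
      apply: (JF B) => //; case: (Fav _ FB) => -[_ BD _ _] _; apply: BD => //.
      by case: Ay => [|/sAB]; [left|right].
    apply: (JF A) => //; case: (Fav _ FA) => -[_ AD _ _] _; apply: AD => //.
    by case: Bz => [|/sBA]; [left|right].
  - by apply: (JF A) => //; case: (Fav _ FA) => -[_ _ Ale _] _; exact: Ale le _.
  - by apply: (JF A) => //; case: (Fav _ FA) => -[_ _ _ Ag] _; exact: Ag.
have pA : prime_gideal (J `|` A).
  apply: (avoiding_prime iA nAx) => I iI sAI nIx y Iy.
  have JI : J `|` I = I by apply/setUidPr => z Jz; apply: sAI; left.
  apply: contrapT => nAy; apply: (maxA I); last by rewrite /avoids JI.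
  split; first by move=> z Az; apply: sAI; right.
  by move=> /(_ y Iy) Ay; apply: nAy; right.
by exists (Spec pA) => // y; left.
Qed.

Lemma gradicalE J : gideal J -> gradical J = J.
Proof.
move=> iJ; apply/seteqP; split; last exact: sub_gradical.
move=> x radx; apply: contrapT => /(exists_spec_avoiding iJ)[P VP]; apply.
exact: radx.
Qed.

Lemma specDx_setTE x : conical M -> specDx x = [set: spec M] <-> order_unit x.
Proof.
move=> conM; rewrite order_unitE //; split=> [DT|genT]; last first.
  rewrite specDxE // genT; apply/seteqP; split=> // P _ sTP.
  by case: (specP P) => _ + _; apply; apply/seteqP; split.
apply/seteqP; split=> // y _; apply: contrapT.
move=> /(exists_spec_avoiding (gideal_gen_gideal _ conM))[P VP _].
have : specDx x P by rewrite DT.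
by apply; apply: VP; exact: sub_gideal_gen.
Qed.

Lemma closed_spec1 (P : spec M) : closed [set P] <-> maximal_gideal P.
Proof.
rewrite closure_id closure_spec1; split=> [VP|[_ _ maxP]]; last first.
  apply/seteqP; split=> Q; first by move=> ->; exact: subset_refl.
  move=> sPQ; apply: spec_inj; case: (maxP Q) => // [|QT].
    exact: spec_gidealP.
  by case: (specP Q).
split; [exact: spec_gidealP|by case: (specP P)|move=> I iI sPI].
have [|/eqP/setTPn[x nIx]] := pselect (I = setT); first by right.
left; apply/seteqP; split=> //.
have [Q sIQ _] := exists_spec_avoiding iI nIx.
have : specV P Q by exact: subset_trans sIQ.
by rewrite -VP => <-.
Qed.

Lemma gnil_radicalE : conical M -> gnil_radical M = [set 0].
Proof.
move=> conM; rewrite -(gradicalE (gideal_set0 conM)) /gnil_radical /gradical.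
congr (bigcap _ _); apply/seteqP; split=> // P _ _ ->.
by case: (spec_gidealP P).
Qed.

Lemma compact_specD J :
    conical M -> gideal J -> finitely_generated J -> cover_compact (specD J).
Proof.
move=> conM iJ [X finX JE] I D f fo sJf.
pose K : set M := [set y | finite_subset_cover D f (specDx y)].
have iK : gideal K.
  split=> [|x y [F1 D1 c1] [F2 D2 c2]|x y le [F DF c]|g x [F DF c]].
  - by exists fset0 => // P; case; case: (spec_gidealP P).
  - exists (F1 `|` F2)%fset => [i|P nPxy].
      by rewrite inE => /orP[/D1|/D2].
    have [Px|nPx] := pselect ((P : set M) x).
      have [i iF fi] : cover [set` F2] f P.
        apply: c2 => Py; apply: nPxy.
        by case: (spec_gidealP P) => _ PD _ _; exact: PD.
      by exists i => //=; rewrite inE (_ : i \in F2) ?orbT.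
    by have [i iF fi] := c1 P nPx; exists i => //=; rewrite inE (_ : i \in F1).
  - exists F => // P nPx; apply: c => Py; apply: nPx.
    by case: (spec_gidealP P) => _ _ Ple _; exact: Ple le Py.
  - exists F => // P nPx; apply: c => Px; apply: nPx.
    by case: (spec_gidealP P) => _ _ _; exact.
have sJK : J `<=` K.
  rewrite -(gradicalE iK) => y Jy P sKP; apply: contrapT => nPy.
  have [i Di fiP] : cover D f P by apply: sJf => sJP; exact/nPy/sJP.
  have [Ji iJi fE] := openP_specD (fo i Di).
  move: fiP; rewrite fE; apply=> z Jiz; apply: sKP.
  exists [fset i]%fset => [j|Q nQz].
    by rewrite !inE => /eqP ->.
  by exists i; rewrite /= ?inE // fE => sQ; exact/nQz/sQ.
have fin_cover y : exists F : {fset I}, K y ->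
    {subset F <= D} /\ specDx y `<=` cover [set` F] f.
  have [[F DF c]|nKy] := pselect (K y); first by exists F.
  by exists fset0.
have {fin_cover}[F FP] := choice fin_cover.
have [S XS] := finite_fsetP.1 finX.
have SK y : y \in S -> K y.
  by move=> yS; apply: sJK; rewrite JE; apply: sub_gideal_gen => //; rewrite XS.
exists (\bigcup_(y <- S) F y)%fset.
  by move=> i /bigfcupP[y /andP[/SK/FP[sFD _] _] /sFD].
move=> P nsJP.
have [y /not_implyP[yS nPy]] : exists y, ~ (y \in S -> (P : set M) y).
  apply/existsNP => sSP; apply: nsJP; rewrite JE.
  by apply: gideal_gen_min; [exact: spec_gidealP|rewrite XS].
have [_ /(_ P nPy)[i iF fiP]] := FP y (SK y yS).
by exists i => //=; apply/bigfcupP; exists y; rewrite ?yS.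
Qed.

Lemma finitely_generated1 x : finitely_generated (gideal_gen [set x]).
Proof. by exists [set x]; first exact: finite_set1. Qed.

Lemma compact_specDx x : conical M -> cover_compact (specDx x).
Proof.
move=> conM; rewrite specDxE //; apply: compact_specD => //.
  exact: gideal_gen_gideal.
exact: finitely_generated1.
Qed.

Lemma spec_spectral_Hochster : conical M ->
    (forall J, gideal J -> finitely_generated J) ->
  spectral_Hochster (spec M).
Proof.
move=> conM fg.
have compact_open (U : set (spec M)) : open U -> cover_compact U.
  by move=> /openP_specD[J iJ ->]; apply: compact_specD => //; exact: fg.
split; [by apply: compact_open; exact: openT| |exact: spec_spectral_HK].
exists open; split=> [|//|A B]; last exact: openI.
split=> // P A; rewrite nbhsE => -[B [oB BP] sBA].
by exists B.
Qed.

End Refinement.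

Theorem proposition3p5 (G : groupType) (M : gMonoidType G)
    (conM : conical M) (ntM : [set: M] <> [set 0]) :
  [/\ (* (i) *)
      forall x : M, specDx x = set0 <-> gnil_radical M x,
      (* (ii) *)
      forall x y : M, specDx x `&` specDx y =
        specD (gideal_gen [set x] `&` gideal_gen [set y]),
      (* (iii) *)
      forall P : spec M, closure [set P] = specV P
    & (* (iv) *)
      kolmogorov_space (spec M)]
  /\
  [/\ (* (v) *)
      forall J : set M, gideal J -> specV J = specV (gradical J),
      (* (vi) *)
      forall J : set M, gideal J ->
        prime_gideal (gradical J) <-> specV J !=set0 /\ irreducible (specV J),
      (* (vii) *)
      sober (spec M)
    & (* (viii) *)
      spectral_HK (spec M)]
  /\
  (refinement M ->
   [/\ (* (1) *)
       forall x : M, specDx x = [set: spec M] <-> order_unit x,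
       (* (2) *)
       forall P : spec M, closed [set P] <-> maximal_gideal P,
       (* (3) *)
       (forall J : set M, gideal J -> J = gradical J) /\ gnil_radical M = [set 0],
       (* (4) *)
       forall x : M, specDx x = set0 <-> x = 0
     & (* (5) *)
       (forall x : M, cover_compact (specDx x)) /\
       ((exists e : M, order_unit e) -> cover_compact [set: spec M])]
   /\
   ((forall J : set M, gideal J -> finitely_generated J) ->
    spectral_Hochster (spec M))).
Proof.
split; [split|split; [split|move=> refM; split; [split|]]].
- exact: specDx_eq0.
- by move=> x y; exact: specD_gideal_genI.
- exact: closure_spec1.
- exact: spec_kolmogorov.
- by move=> J _; rewrite specV_gradical.
- by move=> J _; exact: gradical_prime.
- exact: spec_sober.
- exact: spec_spectral_HK.
- by move=> x; exact: specDx_setTE.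
- exact: closed_spec1.
- by split=> [J iJ|]; [rewrite gradicalE|exact: gnil_radicalE].
- by move=> x; rewrite specDx_eq0 gnil_radicalE.
- split=> [x|[e /specDx_setTE <- //]]; exact: compact_specDx.
- exact: spec_spectral_Hochster.
Qed.
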